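(* Let $h,k>0$ be irrational numbers such that $h+k\in\mathbb{Z}$. Let $Q=Q_{h,k}\subset\mathbb{R}^2$ be the (possibly non-convex) quadrilateral with vertices, in order, $(0,0),(h,0),(1,1),(0,k)$; that is, $Q$ is the union of the triangles $\mathrm{conv}\{(0,0),(h,0),(1,1)\}$ and $\mathrm{conv}\{(0,0),(1,1),(0,k)\}$. Then $Q$ exhibits Ehrhart-theoretic period collapse; more concretely, for every positive integer $t$, $$L_Q(t)=\frac{h+k}{2}t^2+\frac{h+k}{2}t+1.$$ If additionally $1/h+1/k=1$, then $Q$ degenerates to the triangle with vertices $(0,0),(h,0),(0,k)$.
   Context: For a closed (possibly non-convex) polygon $P\subset\mathbb{R}^2$ and a positive integer $t$, the Ehrhart function is $L_P(t)=\#(tP\cap\mathbb{Z}^2)$. A polygon $P$ exhibits Ehrhart-theoretic period collapse if $P$ is not an integer polygon (not all vertices lie in $\mathbb{Z}^2$) and $L_P(t)$, as a function of positive integers $t$, is a polynomial in $t$. *)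

(* Defs.v *)
From HB Require Import structures.
From mathcomp Require Import all_boot all_order all_algebra finmap.
From mathcomp Require Import all_classical all_reals all_analysis.
Export numFieldNormedType.Exports.

Set Implicit Arguments.
Unset Strict Implicit.
Unset Printing Implicit Defensive.

Import Order.TTheory GRing.Theory Num.Theory.
Local Open Scope classical_set_scope.
Local Open Scope ring_scope.

Notation plane R := (R^o * R^o)%type.

Definition convex_hull (R : realType) (S : set (plane R)) : set (plane R) :=
  smallest (fun A => @convex_set R (plane R) A) S.

Definition boundary (R : realType) (P : set (plane R)) : set (plane R) :=
  closure P `\` interior P.

Definition integer_points (R : realType) : set (plane R) :=
  [set p | p.1 \is a Num.int /\ p.2 \is a Num.int].

(* Indices are cyclic: the last edge joins the last vertex to the first. *)
Definition edge_ends (R : realType) (vs : seq (plane R)) (i : nat) :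
    set (plane R) :=
  [set vs`_i; vs`_(i.+1 %% size vs)].

Definition edge (R : realType) (vs : seq (plane R)) (i : nat) :
    set (plane R) :=
  convex_hull (edge_ends vs i).

(* Distinct edges meet only in a common endpoint. Angles of 180 degrees are
   allowed at the vertices. *)
Definition simple_chain (R : realType) (vs : seq (plane R)) : Prop :=
  [/\ (3 <= size vs)%N, uniq vs &
      forall i j : nat, (i < size vs)%N -> (j < size vs)%N -> i != j ->
        edge vs i `&` edge vs j `<=` edge_ends vs i `&` edge_ends vs j].

(* By the Jordan curve theorem, these conditions say exactly that P is the
   union of the closed polygonal chain vs and of the region it encloses: the
   interior of P is a nonempty, bounded, open and relatively closed subset of
   the complement of the chain. *)
Definition polygon_with_vertices (R : realType) (vs : seq (plane R))
    (P : set (plane R)) : Prop :=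
  [/\ simple_chain vs, compact P, interior P !=set0 &
      boundary P = \bigcup_(i in [set i | (i < size vs)%N]) edge vs i].

Definition polygon (R : realType) (P : set (plane R)) : Prop :=
  exists vs, polygon_with_vertices vs P.

(* A list vs for P consists of the corners of P and possibly of some further
   points at which the angle is 180 degrees, so some list is integral if and
   only if all corners of P are. *)
Definition integer_polygon (R : realType) (P : set (plane R)) : Prop :=
  exists2 vs, polygon_with_vertices vs P &
    forall v, v \in vs -> integer_points v.

Definition dilate (R : realType) (t : nat) (P : set (plane R)) :
    set (plane R) :=
  [set (t%:R : R) *: p | p in P].

(* The set counted is finite whenever P is bounded; fset_set would send an
   infinite set to fset0. *)
Definition ehrhart (R : realType) (P : set (plane R)) (t : nat) : nat :=
  #|` fset_set (dilate t P `&` @integer_points R)|.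

Definition period_collapse (R : realType) (P : set (plane R)) : Prop :=
  [/\ polygon P, ~ integer_polygon P &
      exists p : {poly R},
        forall t : nat, (0 < t)%N -> (ehrhart P t)%:R = p.[t%:R]].

Definition quadQ (R : realType) (h k : R) : set (plane R) :=
  convex_hull [set (0, 0); (h, 0); (1, 1)]
  `|` convex_hull [set (0, 0); (1, 1); (0, k)].

(* Main.v *)
(* On a lattice point of the first quadrant put [j = t - min x y]. The point
   lies in the dilate [t Q] if and only if [0 <= j] and
   [- floor (j k) <= x - y <= floor (j h)]. As [h] is irrational and [h + k] is
   an integer, [floor (j h) + floor (j k) = j (h + k) - 1] for [j > 0], so the
   level [j] contains [j (h + k)] points, and the level [0] contains one. *)
Require Import Defs.
From HB Require Import structures.
From mathcomp Require Import all_boot all_order all_algebra finmap.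
From mathcomp Require Import all_classical all_reals all_analysis.
From mathcomp Require Import ring lra zify.

Import Order.TTheory GRing.Theory Num.Theory.
Local Open Scope classical_set_scope.
Local Open Scope ring_scope.

(** * Barycentric coordinates on segments and on triangles with a vertex at the origin *)

Section ConvexHull.
Context {R : realType}.
Implicit Types (S : set (plane R)) (u v p : plane R).

Lemma convex_hull_conv S u v (s : R) : 0 <= s -> s <= 1 ->
  convex_hull S u -> convex_hull S v -> convex_hull S (s *: u + (1 - s) *: v).
Proof.
move=> s0 s1 Su Sv A [cA SA].
have {}Su : u \in A by rewrite inE; exact: Su.
have {}Sv : v \in A by rewrite inE; exact: Sv.
by have := cA _ _ (Itv01 s0 s1) Su Sv; rewrite inE.
Qed.

Lemma convex_hull_segment u v :
  convex_hull [set u; v] =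
  [set p | exists s : R, [/\ 0 <= s, s <= 1,
    p.1 = s * u.1 + (1 - s) * v.1 & p.2 = s * u.2 + (1 - s) * v.2]].
Proof.
apply/seteqP; split => [|[x y] [s [s0 s1 /= -> ->]]]; last first.
  have Su : convex_hull [set u; v] u by apply: sub_gen_smallest; left.
  have Sv : convex_hull [set u; v] v by apply: sub_gen_smallest; right.
  exact: convex_hull_conv s0 s1 Su Sv.
apply: smallest_sub => [x y l|p].
  rewrite !inE => -[a [a0 a1 x1 x2]] [b [b0 b1 y1 y2]].
  have l0 : 0 <= l%:num :> R by [].
  have l1 : l%:num <= 1 :> R by [].
  exists (l%:num * a + (1 - l%:num) * b); split.
  - by rewrite addr_ge0// mulr_ge0// subr_ge0.
  - nra.
  - by rewrite /=/GRing.scale/=/unstable.onem x1 y1; ring.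
  - by rewrite /=/GRing.scale/=/unstable.onem x2 y2; ring.
by case=> ->; [exists 1 | exists 0]; split => //; ring.
Qed.

(** The weight [1 - a - b] of the origin contributes nothing to the coordinates, so two weights and
    one inequality suffice. *)
Lemma convex_hull_triangle u v :
  convex_hull [set 0; u; v] =
  [set p | exists a b : R, [/\ 0 <= a, 0 <= b, a + b <= 1 &
    p.1 = a * u.1 + b * v.1 /\ p.2 = a * u.2 + b * v.2]].
Proof.
apply/seteqP; split => [|[x y] [a [b [a0 b0 ab1 /= [-> ->]]]]]; last first.
  pose T := convex_hull [set 0; u; v].
  have T0 : T 0 by apply: sub_gen_smallest; left; left.
  have Tu : T u by apply: sub_gen_smallest; left; right.
  have Tv : T v by apply: sub_gen_smallest; right.
  change (T (a *: u + b *: v)).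
  have [ab0|ab_neq0] := eqVneq (a + b) 0.
    have -> : a = 0 by lra.
    have -> : b = 0 by lra.
    by rewrite !scale0r addr0.
  have ab_gt0 : 0 < a + b by rewrite lt_neqAle eq_sym ab_neq0 addr_ge0.
  (* The combination is formed in two stages: [u] and [v] are mixed with weights normalised by
     [a + b], and the result is mixed with the origin. *)
  have -> : a *: u + b *: v = (a + b) *: ((a / (a + b)) *: u +
      (1 - a / (a + b)) *: v) + (1 - (a + b)) *: 0.
    rewrite scaler0 addr0 scalerDr !scalerA; congr (_ *: _ + _ *: _); by field.
  apply: convex_hull_conv => //; first lra.
  apply: convex_hull_conv => //; first by rewrite divr_ge0// ltW.
  by rewrite ler_pdivrMr// mul1r lerDl.
apply: smallest_sub => [x y l|p].
  rewrite !inE => -[a [b [a0 b0 ab1 [x1 x2]]]] [c [d [c0 d0 cd1 [y1 y2]]]].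
  have l0 : 0 <= l%:num :> R by [].
  have l1 : l%:num <= 1 :> R by [].
  exists (l%:num * a + (1 - l%:num) * c), (l%:num * b + (1 - l%:num) * d).
  split.
  - by rewrite addr_ge0// mulr_ge0// subr_ge0.
  - by rewrite addr_ge0// mulr_ge0// subr_ge0.
  - nra.
  - by rewrite /=/GRing.scale/=/unstable.onem x1 x2 y1 y2; split; ring.
case=> [[]|] ->; [exists 0, 0 | exists 1, 0 | exists 0, 1].
- by split; rewrite ?addr0//=; split; ring.
- by split; rewrite ?addr0//=; split; ring.
- by split; rewrite ?add0r//=; split; ring.
Qed.

End ConvexHull.

(** Follows from continuity of the ray at parameter 0. It serves to refute interiority, by choosing
    a direction [d] that leaves [A] at once. *)
Lemma interior_ray {R : realType} (A : set (plane R)) (p d : plane R) :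
  interior A p -> exists2 s : R, 0 < s & A (p + s *: d).
Proof.
move=> Ap.
have ray_cvg : p + (s : R^o) *: d @[s --> (0:R^o)] --> p + (0 : R^o) *: d.
  by apply: cvgD; [exact: cvg_cst|apply: cvgZr_tmp; exact: cvg_id].
rewrite scale0r addr0 in ray_cvg.
have /nbhs_ballP[e /= e0 eA] := ray_cvg _ Ap.
exists (e / 2); first by rewrite divr_gt0.
by apply: eA; rewrite /ball/= sub0r normrN ger0_norm; lra.
Qed.

(** * The quadrilateral and its dilates as sublevel sets of the gauge *)

Section Gauge.
Context {R : realType} (h k : R).
Hypotheses (h_gt0 : 0 < h) (k_gt0 : 0 < k).
Implicit Types (p : plane R) (t : R).

(* On the first quadrant this is the Minkowski functional of [quadQ h k]. *)
Definition gauge p : R :=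
  Num.min p.1 p.2 + Num.max (p.1 - p.2) 0 / h + Num.max (p.2 - p.1) 0 / k.

Lemma gauge_below p : p.2 <= p.1 -> gauge p = p.2 + (p.1 - p.2) / h.
Proof.
move=> yx; rewrite /gauge min_r// max_l ?subr_ge0// max_r ?subr_le0//.
by rewrite mul0r addr0.
Qed.

Lemma gauge_above p : p.1 <= p.2 -> gauge p = p.1 + (p.2 - p.1) / k.
Proof.
move=> xy; rewrite /gauge min_l// max_r ?subr_le0// max_l ?subr_ge0//.
by rewrite mul0r addr0.
Qed.

(** Clearing the denominator gives, with [j = t - p.2], the bound [x - y <= j h] that describes a
    level of lattice points. *)
Lemma gauge_le_below p t : p.2 <= p.1 ->
  (gauge p <= t) = (p.1 - p.2 <= (t - p.2) * h).
Proof. by move=> yx; rewrite gauge_below// -lerBrDl ler_pdivrMr. Qed.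

Lemma gauge_le_above p t : p.1 <= p.2 ->
  (gauge p <= t) = (p.2 - p.1 <= (t - p.1) * k).
Proof. by move=> xy; rewrite gauge_above// -lerBrDl ler_pdivrMr. Qed.

Lemma gauge_eq_below p t : p.2 <= p.1 ->
  (gauge p = t) <-> (p.1 - p.2 = (t - p.2) * h).
Proof.
move=> yx; rewrite gauge_below//; split=> [<-|->].
  by rewrite [X in X * _]addrAC subrr add0r divfK ?lt0r_neq0.
by rewrite mulfK ?lt0r_neq0// addrC subrK.
Qed.

Lemma gauge_eq_above p t : p.1 <= p.2 ->
  (gauge p = t) <-> (p.2 - p.1 = (t - p.1) * k).
Proof.
move=> xy; rewrite gauge_above//; split=> [<-|->].
  by rewrite [X in X * _]addrAC subrr add0r divfK ?lt0r_neq0.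
by rewrite mulfK ?lt0r_neq0// addrC subrK.
Qed.

Lemma gauge_scale (s : R) p : 0 <= s -> gauge (s *: p) = s * gauge p.
Proof.
move=> s0; have [yx|/ltW xy] := leP p.2 p.1.
  by rewrite !gauge_below ?ler_wpM2l//=/GRing.scale/=; ring.
by rewrite !gauge_above ?ler_wpM2l//=/GRing.scale/=; ring.
Qed.

(** The expression by [min] and [max] is continuous term by term, without gluing along the
    diagonal. *)
Lemma gauge_continuous : continuous (gauge : plane R -> R^o).
Proof.
move=> p.
have cfst : {for p, continuous (fst : plane R -> R^o)} by exact: cvg_fst.
have csnd : {for p, continuous (snd : plane R -> R^o)} by exact: cvg_snd.
have cst0 : {for p, continuous (cst 0 : plane R -> R^o)} by exact: cvg_cst.
have cmax0 (u v : plane R -> R^o) :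
    {for p, continuous u} -> {for p, continuous v} ->
    {for p, continuous ((fun q => u q - v q) \max cst 0)}.
  by move=> cu cv; apply: continuous_max => //; exact: cvgB.
apply: cvgD; [apply: cvgD|].
- exact: (continuous_min cfst csnd).
- by apply: cvgMr_tmp; exact: (cmax0 _ _ cfst csnd).
- by apply: cvgMr_tmp; exact: (cmax0 _ _ csnd cfst).
Qed.

(** The diagonal cuts the quadrant into two cones, each containing one of the triangles; on either
    cone the gauge is the sum [a + b] of the two barycentric weights. *)
Lemma quadQE :
  quadQ h k = [set p | [/\ 0 <= p.1, 0 <= p.2 & gauge p <= 1]].
Proof.
rewrite /quadQ !convex_hull_triangle; apply/seteqP; split=> -[x y] /=.
  case=> -[a [b [a0 b0 ab1 [-> ->]]]].
    have ah : 0 <= a * h by rewrite mulr_ge0// ltW.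
    (* The bound on [a + b] is multiplied by [h] because the gauge bound at this point reads
       [a * h <= (1 - b) * h]. *)
    have := ler_wpM2r (ltW h_gt0) ab1.
    by rewrite gauge_le_below/=; [split; lra|lra].
  have bk : 0 <= b * k by rewrite mulr_ge0// ltW.
  have := ler_wpM2r (ltW k_gt0) ab1.
  by rewrite gauge_le_above/=; [split; lra|lra].
move=> [x0 y0]; have [yx|/ltW xy] := leP y x.
  (* These weights solve [x = a * h + b] and [y = b]. *)
  rewrite gauge_below//= => g1; left; exists ((x - y) / h), y; split.
  - by rewrite divr_ge0 ?subr_ge0// ltW.
  - by [].
  - lra.
  - by rewrite divfK ?lt0r_neq0//; split; lra.
rewrite gauge_above//= => g1; right; exists x, ((y - x) / k); split.
- by [].
- by rewrite divr_ge0 ?subr_ge0// ltW.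
- lra.
- by rewrite divfK ?lt0r_neq0//; split; lra.
Qed.

Lemma dilate_quadQ (t : nat) : (0 < t)%N ->
  dilate t (quadQ h k) =
  [set p | [/\ 0 <= p.1, 0 <= p.2 & gauge p <= t%:R]].
Proof.
move=> t0; have t0R : 0 < t%:R :> R by rewrite ltr0n.
rewrite quadQE; apply/seteqP; split => p /=.
  move=> [q [x0 y0 g1] <-]; rewrite gauge_scale ?ler0n//.
  split; [exact: mulr_ge0|exact: mulr_ge0|].
  by rewrite -[leRHS]mulr1 ler_pM2l.
move=> [x0 y0 g1]; exists (t%:R^-1 *: p); last first.
  by rewrite scalerA mulfV ?lt0r_neq0// scale1r.
rewrite /mkset gauge_scale ?invr_ge0 ?ler0n// mulrC ler_pdivrMr// mul1r.
by split => //; apply: mulr_ge0; rewrite ?invr_ge0 ?ler0n.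
Qed.

End Gauge.

(** * The quadrilateral is a polygon with a non-integral corner *)

Section QuadPolygon.
Context {R : realType} (h k : R).
Hypotheses (h_gt0 : 0 < h) (k_gt0 : 0 < k).
Implicit Types p : plane R.

Let vs : seq (plane R) := [:: (0, 0); (h, 0); (1, 1); (0, k)].

Lemma edge0E : edge vs 0 = [set p | [/\ p.2 = 0, 0 <= p.1 & p.1 <= h]].
Proof.
rewrite /edge/edge_ends/= convex_hull_segment.
apply/seteqP; split=> -[x y] /=.
  move=> [s [s0 s1 -> ->]]; have ? := mulr_ge0 s0 (ltW h_gt0).
  have ? : 0 <= (1 - s) * h by rewrite mulr_ge0 ?subr_ge0// ltW.
  by split; lra.
move=> [-> x0 xh]; exists (1 - x / h); split.
- by rewrite subr_ge0 ler_pdivrMr// mul1r.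
- by rewrite gerBl divr_ge0// ltW.
- by field; exact: lt0r_neq0.
- by ring.
Qed.

Lemma edge1E :
  edge vs 1 = [set p | [/\ 0 <= p.2, p.2 <= 1 & p.1 = p.2 + h * (1 - p.2)]].
Proof.
rewrite /edge/edge_ends/= convex_hull_segment.
apply/seteqP; split=> -[x y] /=.
  by move=> [s [s0 s1 -> ->]]; split; lra.
by move=> [y0 y1 ->]; exists (1 - y); split; lra.
Qed.

Lemma edge2E :
  edge vs 2 = [set p | [/\ 0 <= p.1, p.1 <= 1 & p.2 = p.1 + k * (1 - p.1)]].
Proof.
rewrite /edge/edge_ends/= convex_hull_segment.
apply/seteqP; split=> -[x y] /=.
  by move=> [s [s0 s1 -> ->]]; split; lra.
by move=> [x0 x1 ->]; exists x; split; lra.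
Qed.

Lemma edge3E : edge vs 3 = [set p | [/\ p.1 = 0, 0 <= p.2 & p.2 <= k]].
Proof.
rewrite /edge/edge_ends/= convex_hull_segment.
apply/seteqP; split=> -[x y] /=.
  move=> [s [s0 s1 -> ->]]; have ? := mulr_ge0 s0 (ltW k_gt0).
  have ? : 0 <= (1 - s) * k by rewrite mulr_ge0 ?subr_ge0// ltW.
  by split; lra.
move=> [-> y0 yk]; exists (y / k); split.
- by rewrite divr_ge0// ltW.
- by rewrite ler_pdivrMr// mul1r.
- by ring.
- by field; exact: lt0r_neq0.
Qed.

(** Edge 1 lies on or below the diagonal and edge 2 on or above it, so they meet only at [(1, 1)].
    The opposite pairs 0, 2 and 1, 3 could meet only if [k = 0] or [h = 0]. The other pairs meet at
    a vertex on an axis. *)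
Lemma quad_edges_meet i j p : (i < j < 4)%N -> edge vs i p -> edge vs j p ->
  edge_ends vs i p /\ edge_ends vs j p.
Proof.
case: p => x y.
case: j => [|[|[|[|j]]]]; case: i => [|[|[|i]]]; rewrite ?andbF//= => _;
  rewrite ?edge0E ?edge1E ?edge2E ?edge3E /edge_ends/=.
- move=> [-> x0 xh] [_ _ ->].
  by rewrite subr0 mulr1 add0r; split; [right|left].
- move=> [-> x0 xh] [_ x1 yE].
  have ? : 0 <= k * (1 - x) by rewrite mulr_ge0 ?(ltW k_gt0)// subr_ge0.
  have xE : x = 0 by lra.
  by move: yE k_gt0; rewrite xE subr0 mulr1 add0r => <-; rewrite ltxx.
- move=> [y0 y1 xE] [x0 x1 yE].
  have hy : 0 <= h * (1 - y) by rewrite mulr_ge0 ?(ltW h_gt0)// subr_ge0.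
  have kx : 0 <= k * (1 - x) by rewrite mulr_ge0 ?(ltW k_gt0)// subr_ge0.
  have /eqP : h * (1 - y) = 0 by lra.
  rewrite mulf_eq0 gt_eqF//= => /eqP y1E.
  have yE1 : y = 1 by lra.
  have xE1 : x = 1 by rewrite xE yE1; ring.
  by rewrite xE1 yE1; split; [right|left].
- by move=> [-> _ _] [-> _ _]; split; [left|right].
- move=> [y0 y1 xE] [x0 _ _]; rewrite {}x0 in xE.
  have ? : 0 <= h * (1 - y) by rewrite mulr_ge0 ?(ltW h_gt0)// subr_ge0.
  have yE : y = 0 by lra.
  by move: xE h_gt0; rewrite yE subr0 mulr1 add0r => <-; rewrite ltxx.
- move=> [_ _ ->] [-> _ _].
  by rewrite subr0 mulr1 add0r; split; [right|left].
Qed.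

Lemma quad_simple_chain : simple_chain vs.
Proof.
have h0 := gt_eqF h_gt0; have k0 := gt_eqF k_gt0.
split=> //.
  by rewrite /= !inE !xpair_eqE !eqxx ?(eq_sym 0) h0 k0 oner_eq0 ?andbF.
move=> i j iv jv ij p [pi pj].
have [ltij|ltji|eqij] := ltngtP i j.
- by have [] := @quad_edges_meet i j p; rewrite // ltij.
- by have [] := @quad_edges_meet j i p; rewrite // ltji.
- by rewrite eqij eqxx in ij.
Qed.

(** A crude box, enough for compactness: below the diagonal [x <= y + (1 - y) h] with [0 <= y <= 1],
    and symmetrically above. *)
Lemma quadQ_bounded p : quadQ h k p ->
  [/\ 0 <= p.1 <= 1 + h & 0 <= p.2 <= 1 + k].
Proof.
have h0 : (0 : R^o) < h by []; have k0 : (0 : R^o) < k by [].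
rewrite quadQE//; case: p => x y /= [x0 y0].
have [yx|/ltW xy] := leP y x.
  rewrite gauge_le_below//= => g1.
  have : 0 <= (1 - y) * h by lra.
  rewrite pmulr_lge0// subr_ge0 => y1.
  have ? : 0 <= y * h by rewrite mulr_ge0// ltW.
  by split; apply/andP; split; lra.
rewrite gauge_le_above//= => g1.
have : 0 <= (1 - x) * k by lra.
rewrite pmulr_lge0// subr_ge0 => x1.
have ? : 0 <= x * k by rewrite mulr_ge0// ltW.
by split; apply/andP; split; lra.
Qed.

Lemma quadQ_closed : closed (quadQ h k).
Proof.
rewrite quadQE//.
rewrite [X in closed X](_ : _ =
  (fst : plane R -> R^o) @^-1` [set x | 0 <= x] `&`
  (snd : plane R -> R^o) @^-1` [set x | 0 <= x] `&`
  (gauge h k : plane R -> R^o) @^-1` [set x | x <= 1]); last first.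
  by apply/seteqP; split=> p /= => [[]|[[]]].
apply: closedI; [apply: closedI|]; apply: closed_comp => //.
- by move=> p _; exact: cvg_fst.
- by move=> p _; exact: cvg_snd.
- by move=> p _; exact: gauge_continuous.
Qed.

Lemma quadQ_compact : compact (quadQ h k).
Proof.
apply: (subclosed_compact quadQ_closed
  (compact_setX (@segment_compact R 0 (1 + h)) (@segment_compact R 0 (1 + k)))).
by move=> p /quadQ_bounded[p1 p2]; split; rewrite /= in_itv.
Qed.

(** The strict inequalities cut out an open set. Conversely, a point with an equality leaves the
    quadrilateral along a suitable ray: leftwards, downwards or radially. *)
Lemma quadQ_interior :
  interior (quadQ h k) = [set p | [/\ 0 < p.1, 0 < p.2 & gauge h k p < 1]].
Proof.
apply/seteqP; split=> [p Qp|].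
  have := interior_subset Qp; rewrite quadQE// => -[x0 y0 g1].
  split.
  - rewrite lt_neqAle x0 andbT; apply/eqP => p1.
    have [s s0] := @interior_ray _ _ _ ((-1, 0) : plane R) Qp.
    rewrite quadQE// => -[/= + _ _]; rewrite -p1 /GRing.scale/=; lra.
  - rewrite lt_neqAle y0 andbT; apply/eqP => p2.
    have [s s0] := @interior_ray _ _ _ ((0, -1) : plane R) Qp.
    rewrite quadQE// => -[/= _ + _]; rewrite -p2 /GRing.scale/=; lra.
  - rewrite lt_neqAle g1 andbT; apply/eqP => gp.
    (* Radial direction: by homogeneity the gauge becomes [1 + s > 1]. *)
    have [s s0] := @interior_ray _ _ _ p Qp.
    rewrite quadQE// -[X in X + _]scale1r -scalerDl => -[_ _].
    by rewrite gauge_scale ?gp; lra.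
rewrite -open_subsetE; last first.
  rewrite [X in open X](_ : _ = (fst : plane R -> R^o) @^-1` [set x | 0 < x] `&`
    (snd : plane R -> R^o) @^-1` [set x | 0 < x] `&`
    (gauge h k : plane R -> R^o) @^-1` [set x | x < 1]); last first.
    by apply/seteqP; split=> p /= => [[]|[[]]].
  apply: openI; [apply: openI|]; apply: open_comp => //.
  - by move=> p _; exact: cvg_fst.
  - by move=> p _; exact: cvg_snd.
  - by move=> p _; exact: gauge_continuous.
by rewrite quadQE// => p [/ltW ? /ltW ? /ltW ?].
Qed.

(** As the set is closed, its boundary consists of the points where one of the three defining
    inequalities is an equality: the axes give edges 0 and 3, and gauge 1 gives edge 1 below the
    diagonal and edge 2 above it. *)
Lemma quadQ_boundary :
  boundary (quadQ h k) = \bigcup_(i in [set i | (i < size vs)%N]) edge vs i.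
Proof.
rewrite /boundary -(closure_id _).1; last exact: quadQ_closed.
rewrite quadQ_interior quadQE//; apply/seteqP; split=> -[x y] /=.
  move=> [[x0 y0 g1] ni].
  have [xE|x_neq0] := eqVneq x 0.
    exists 3 => //; rewrite edge3E/=.
    move: g1; rewrite gauge_le_above/= ?xE//; split; lra.
  have [yE|y_neq0] := eqVneq y 0.
    exists 0 => //; rewrite edge0E/=.
    move: g1; rewrite gauge_le_below/= ?yE//; split; lra.
  (* Both coordinates are now positive, so only the gauge inequality can fail to be strict. *)
  have /eqP gE : gauge h k (x, y) == 1.
    apply: contra_notT ni => gn1.
    by rewrite !lt_neqAle !(eq_sym 0) x_neq0 y_neq0 gn1.
  have [yx|/ltW xy] := leP y x.
    move/(gauge_eq_below _ _ h_gt0 (x, y) _ yx) : gE => /= gE; exists 1 => //.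
    have : 0 <= (1 - y) * h by rewrite -gE subr_ge0.
    by rewrite pmulr_lge0// subr_ge0 edge1E/= => y1; split; lra.
  move/(gauge_eq_above _ _ k_gt0 (x, y) _ xy) : gE => /= gE; exists 2 => //.
  have : 0 <= (1 - x) * k by rewrite -gE subr_ge0.
  by rewrite pmulr_lge0// subr_ge0 edge2E/= => x1; split; lra.
move=> [[|[|[|[|]]]]]//= _.
- rewrite edge0E => -[/= -> x0 xh]; split; last by rewrite ltxx => -[].
  by rewrite gauge_le_below//=; split; lra.
- rewrite edge1E => -[/= y0 y1 xE].
  have ? : 0 <= h * (1 - y) by rewrite mulr_ge0 ?(ltW h_gt0)// subr_ge0.
  have yx : y <= x by lra.
  have -> : gauge h k (x, y) = 1 by apply/gauge_eq_below => //=; lra.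
  by split; [split; lra|rewrite ltxx => -[]].
- rewrite edge2E => -[/= x0 x1 yE].
  have ? : 0 <= k * (1 - x) by rewrite mulr_ge0 ?(ltW k_gt0)// subr_ge0.
  have xy : x <= y by lra.
  have -> : gauge h k (x, y) = 1 by apply/gauge_eq_above => //=; lra.
  by split; [split; lra|rewrite ltxx => -[]].
- rewrite edge3E => -[/= -> y0 yk]; split; last by rewrite ltxx => -[].
  by rewrite gauge_le_above//=; split; lra.
Qed.

Lemma quadQ_polygon : polygon_with_vertices vs (quadQ h k).
Proof.
split; [exact: quad_simple_chain|exact: quadQ_compact| |exact: quadQ_boundary].
(* The midpoint of the diagonal has gauge [1 / 2] whatever [h] and [k] are. *)
exists ((2^-1, 2^-1) : plane R); rewrite quadQ_interior/=.
rewrite gauge_below//= subrr mul0r addr0.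
by split; rewrite ?invr_gt0 ?invf_lt1 ?ltr1n.
Qed.

(* An integral edge through the corner [(h, 0)] would have both ends on the
   side [y = 0] of the half-plane containing [quadQ h k], at abscissae smaller
   than [h]. *)
Lemma quadQ_not_integer_polygon : h \isn't a Num.int ->
  ~ integer_polygon (quadQ h k).
Proof.
move=> hNint [ws [[ws3 _ _] _ _ bQ] wsZ].
have end_bound u : quadQ h k u -> u \in ws ->
    [/\ u.1 != h, 0 <= u.2 & u.2 = 0 -> u.1 < h].
  rewrite quadQE// => -[u1 u2 gu] /wsZ[uZ _].
  have u1h : u.1 != h by apply: contraNneq hNint => <-.
  split=> // u20; rewrite lt_neqAle u1h/=.
  by move: gu; rewrite gauge_le_below// ?u20// !subr0 mul1r.
(* The list [ws] is arbitrary, so the corner is only known to lie on some edge of it, through the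
   boundary. *)
have : (\bigcup_(i in [set i | (i < size ws)%N]) edge ws i) (h, 0).
  by rewrite -bQ quadQ_boundary; exists 0 => //; rewrite edge0E; split;
    rewrite //= ltW.
move=> [i /= iws ih].
have iQ : edge ws i `<=` quadQ h k.
  move=> p pi; have : boundary (quadQ h k) p by rewrite bQ; exists i.
  by rewrite /boundary -(closure_id _).1; [case|exact: quadQ_closed].
have := end_bound (ws`_i); have := end_bound (ws`_(i.+1 %% size ws)).
have iQl : quadQ h k (ws`_i) by apply: iQ; apply: sub_gen_smallest; left.
have iQr : quadQ h k (ws`_(i.+1 %% size ws)).
  by apply: iQ; apply: sub_gen_smallest; right.
move=> /(_ iQr) vB /(_ iQl) uB.
move: vB; rewrite mem_nth ?ltn_pmod ?(leq_trans _ ws3)// => /(_ isT) vB.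
move: uB; rewrite mem_nth// => /(_ isT) uB.
move: ih uB vB; rewrite /edge convex_hull_segment => -[s /= [s0 s1 hE yE]].
move: hE yE; move: (ws`_i) (ws`_(i.+1 %% size ws)) => [/= ux uy] [/= vx vy].
move=> hE yE [u1 u2 u3] [v1 v2 v3].
(* At [s = 0] or [s = 1] the corner would itself be an end of the edge, hence integral. *)
have [sE|s_neq0] := eqVneq s 0.
  by move/eqP: v1; apply; rewrite hE sE; ring.
have [sE|s_neq1] := eqVneq s 1.
  by move/eqP: u1; apply; rewrite hE sE; ring.
have s_gt0 : 0 < s by rewrite lt_neqAle eq_sym s_neq0.
have s_lt1 : 0 < 1 - s by rewrite subr_gt0 lt_neqAle s_neq1.
(* Nonnegative ordinates with weighted mean 0 and positive weights both vanish. *)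
have su : 0 <= s * uy by rewrite mulr_ge0.
have sv : 0 <= (1 - s) * vy by rewrite mulr_ge0// ltW.
have /eqP : s * uy = 0 by lra.
rewrite mulf_eq0 (negbTE s_neq0)/= => /eqP/u3 uh.
have /eqP : (1 - s) * vy = 0 by lra.
rewrite mulf_eq0 gt_eqF//= => /eqP/v3 vh.
have : s * ux < s * h by rewrite ltr_pM2l.
have : (1 - s) * vx < (1 - s) * h by rewrite ltr_pM2l.
lra.
Qed.

End QuadPolygon.

(** Reduces counting a set to the length of an explicit enumeration. *)
Lemma card_fset_set_seq (T : choiceType) (s : seq T) :
  uniq s -> #|` fset_set [set` s]| = size s.
Proof.
move=> s_uniq; rewrite (_ : [set` s] = [set` [fset x in s]%fset]).
  by rewrite set_fsetK card_fseq undup_id.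
by apply/funext=> x; rewrite /= inE.
Qed.

(** * Counting lattice points level by level *)

Section LatticePoints.
Context {R : realType} (h k : R).
Hypotheses (h_gt0 : 0 < h) (k_gt0 : 0 < k).

(* The points with [min x y = t - j] are indexed by [e], the value of [x - y]
   shifted by the largest admissible value of [y - x]. Subtraction is
   truncated: [e - _] and [_ - e] are the positive and negative parts of
   [x - y]. *)
Definition quad_lattice_points (t : nat) : seq (plane R) :=
  [seq ((t - j + (e - Num.truncn (j%:R * k)))%:R : R,
        (t - j + (Num.truncn (j%:R * k) - e))%:R : R)
  | j <- iota 0 t.+1,
    e <- iota 0 (Num.truncn (j%:R * h) + Num.truncn (j%:R * k)).+1].

Lemma quad_lattice_pointsP t (p : plane R) :
  p \in quad_lattice_points t <-> exists j e, [/\ (j <= t)%N,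
    (e <= Num.truncn (j%:R * h) + Num.truncn (j%:R * k))%N &
    p = ((t - j + (e - Num.truncn (j%:R * k)))%:R,
         (t - j + (Num.truncn (j%:R * k) - e))%:R)].
Proof.
split=> [/allpairsPdep[j [e []]]|[j [e [jt eab ->]]]].
  by rewrite !mem_iota !add0n !ltnS => jt eab ->; exists j, e.
by apply/allpairs_f_dep; rewrite mem_iota add0n ltnS.
Qed.

(** One of the two truncated differences vanishes, so the smaller coordinate is [t - j], which
    determines [j] because [j <= t]; the difference of the coordinates then determines [e]. *)
Lemma quad_lattice_points_uniq t : uniq (quad_lattice_points t).
Proof.
apply: allpairs_uniq_dep; first exact: iota_uniq.
  by move=> j _; exact: iota_uniq.
move=> _ _ /allpairsPdep[j [e [jt _ ->]]] /allpairsPdep[j' [e' [jt' _ ->]]].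
move: jt jt'; rewrite !mem_iota !add0n !ltnS => jt jt' /=.
move=> /pair_equal_spec[/eqP + /eqP]; rewrite !eqr_nat => /eqP xE /eqP yE.
have jj' : j = j' by lia.
by subst j'; have -> : e = e' by lia.
Qed.

Lemma mem_quad_lattice_points t (p : plane R) : (0 < t)%N ->
  (dilate t (quadQ h k) `&` @integer_points R) p <->
  p \in quad_lattice_points t.
Proof.
move=> t0; rewrite dilate_quadQ//; split.
  case: p => x y [[/= x0 y0 gp] [/= xZ yZ]].
  have /natrP[m xE] : x \is a Num.nat by rewrite natrEint xZ.
  have /natrP[n yE] : y \is a Num.nat by rewrite natrEint yZ.
  rewrite {}xE {}yE in gp *.
  apply/quad_lattice_pointsP; have [nm|/ltnW mn] := leqP n m.
    move: gp; rewrite gauge_le_below//= ?ler_nat// -natrB// => gp.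
    (* Since [0 <= m - n <= (t - n) h] with [h > 0], the factor [t - n] is nonnegative, so natural
       subtraction is exact. *)
    have nt : (n <= t)%N.
      rewrite -(ler_nat R) -subr_ge0 -(pmulr_lge0 _ h_gt0).
      exact: le_trans gp.
    rewrite -natrB// in gp.
    have ma : (m - n <= Num.truncn ((t - n)%:R * h))%N.
      by rewrite truncn_ge_nat// mulr_ge0// ltW.
    (* The level is [t - min m n], and [e] is [m - n] after the shift. *)
    exists (t - n)%N, (Num.truncn ((t - n)%:R * k) + (m - n))%N.
    by split; [lia|lia|congr (_%:R, _%:R); lia].
  move: gp; rewrite gauge_le_above//= ?ler_nat// -natrB// => gp.
  have mt : (m <= t)%N.
    rewrite -(ler_nat R) -subr_ge0 -(pmulr_lge0 _ k_gt0).
    exact: le_trans gp.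
  exists (t - m)%N, (Num.truncn ((t - m)%:R * k) - (n - m))%N.
  rewrite -natrB// in gp.
  have nb : (n - m <= Num.truncn ((t - m)%:R * k))%N.
    by rewrite truncn_ge_nat// mulr_ge0// ltW.
  by split; [lia|lia|congr (_%:R, _%:R); lia].
move=> /quad_lattice_pointsP[j [e [jt eab ->]]].
split; last by split; rewrite /= natr_int.
split; rewrite /= ?ler0n//.
have [be|/ltnW eb] := leqP (Num.truncn (j%:R * k)) e.
  rewrite gauge_le_below//= ?ler_nat; last lia.
  rewrite -natrB; last lia.
  rewrite (_ : (_ - (_ + _))%N = (e - Num.truncn (j%:R * k))%N); last lia.
  rewrite -natrB; last lia.
  rewrite (_ : (t - _)%N = j); last lia.
  by rewrite -truncn_ge_nat; [rewrite leq_subLR addnC|rewrite mulr_ge0// ltW].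
rewrite gauge_le_above//= ?ler_nat; last lia.
rewrite -natrB; last lia.
rewrite (_ : (_ - (_ + _))%N = (Num.truncn (j%:R * k) - e)%N); last lia.
rewrite -natrB; last lia.
rewrite (_ : (t - _)%N = j); last lia.
by rewrite -truncn_ge_nat; [rewrite leq_subr|rewrite mulr_ge0// ltW].
Qed.

Lemma ehrhart_quadQ t : (0 < t)%N -> ehrhart (quadQ h k) t =
  (\sum_(0 <= j < t.+1) (Num.truncn (j%:R * h) + Num.truncn (j%:R * k)).+1)%N.
Proof.
move=> t0; rewrite /ehrhart.
rewrite (_ : _ `&` _ = [set` quad_lattice_points t]); last first.
  by apply/funext=> p; apply/propext; exact: mem_quad_lattice_points.
rewrite card_fset_set_seq ?quad_lattice_points_uniq//.
rewrite size_allpairs_dep sumnE big_map /index_iota subn0.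
by under eq_bigr do rewrite size_iota.
Qed.

Hypotheses (h_irr : irrational h) (hk_int : h + k \is a Num.int).

Lemma irrational_mul_nat_neq_int j (m : int) : (0 < j)%N -> j%:R * h != m%:~R.
Proof.
move=> j0; apply/eqP => jh; apply: h_irr; apply/rationalP; exists m, j.
by rewrite -jh mulrC mulKf// pnatr_eq0 -lt0n.
Qed.

(** Writing [a] and [b] for the truncations, [a < j h < a + 1], strictly on the left because [j h]
    is not an integer, and [b <= j k < b + 1]. The integer [j (h + k)] thus lies strictly between
    [a + b] and [a + b + 2]. *)
Lemma truncn_complementary j : (0 < j)%N ->
  (Num.truncn (j%:R * h) + Num.truncn (j%:R * k)).+1%:R = j%:R * (h + k) :> R.
Proof.
move=> j0.
have /intrP[n nE] : j%:R * (h + k) \is a Num.int by rewrite rpredM// natr_int.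
have /truncn_itv : 0 <= j%:R * h by rewrite mulr_ge0// ltW.
have /truncn_itv : 0 <= j%:R * k by rewrite mulr_ge0// ltW.
have /eqP := irrational_mul_nat_neq_int j (Num.truncn (j%:R * h)) j0.
move: (Num.truncn (j%:R * h)) (Num.truncn (j%:R * k)) => a b.
rewrite -pmulrn => ha /andP[b1 b2] /andP[a1 a2].
have {ha} a1 : a%:R < j%:R * h.
  by rewrite lt_neqAle a1 andbT; apply/eqP => /esym.
rewrite nE; rewrite mulrDr in nE.
rewrite pmulrn; congr (_%:~R); apply/eqP; rewrite eq_le.
(* Over the integers [x <= y] becomes [x < y + 1], so that strict real bounds yield equality. *)
rewrite -ltzD1 -[X in _ && X]ltzD1 -!(ltr_int R) !intrD/= -!pmulrn.
move: a1 a2 b1 b2; rewrite -!natr1 !natrD => a1 a2 b1 b2.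
by apply/andP; split; lra.
Qed.

Lemma ehrhart_quadQ_formula t : (0 < t)%N -> (ehrhart (quadQ h k) t)%:R
  = (h + k) / 2 * t%:R ^+ 2 + (h + k) / 2 * t%:R + 1 :> R.
Proof.
move=> t0; rewrite ehrhart_quadQ// natr_sum {t0}.
(* The induction starts at 0, where only the single point of level 0 is counted; level [t + 1] adds
   [(t + 1) (h + k)]. *)
elim: t => [|t IH].
  by rewrite big_nat1 !mul0r truncn0 expr0n !mulr0 !add0r.
rewrite big_nat_recr//= IH truncn_complementary// -natr1; by field.
Qed.

End LatticePoints.

(** The condition puts [(1, 1)] on the line [x / h + y / k = 1], and both branches of the gauge
    become the same linear form. *)
Lemma quadQ_degenerate {R : realType} (h k : R) : 0 < h -> 0 < k ->
  h^-1 + k^-1 = 1 -> quadQ h k = convex_hull [set (0, 0); (h, 0); (0, k)].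
Proof.
move=> h0 k0 hk.
have gaugeE (p : plane R) : gauge h k p = p.1 / h + p.2 / k.
  have [yx|/ltW xy] := leP p.2 p.1.
    (* The coefficient 1 of the smaller coordinate is replaced by [h^-1 + k^-1]. *)
    by rewrite gauge_below// -[X in X + _]mulr1 -hk; ring.
  by rewrite gauge_above// -[X in X + _]mulr1 -hk; ring.
rewrite quadQE// convex_hull_triangle; apply/seteqP; split=> -[x y] /=.
  move=> [x0 y0]; rewrite gaugeE => g1; exists (x / h), (y / k).
  split; rewrite ?divr_ge0 ?(ltW h0) ?(ltW k0)//.
  by rewrite !divfK ?lt0r_neq0// !mulr0 addr0 add0r.
move=> [a [b [a0 b0 ab1]]]; rewrite !mulr0 addr0 add0r => -[-> ->].
by rewrite gaugeE/= !mulfK ?lt0r_neq0// !mulr_ge0// ltW.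
Qed.

Theorem theorem1p3 (R : realType) (h k : R)
    (h_gt0 : 0 < h) (k_gt0 : 0 < k)
    (h_irr : irrational h) (k_irr : irrational k)
    (hk_int : h + k \is a Num.int) :
  [/\ polygon_with_vertices [:: (0, 0); (h, 0); (1, 1); (0, k)] (quadQ h k),
      period_collapse (quadQ h k),
      (forall t : nat, (0 < t)%N ->
         (ehrhart (quadQ h k) t)%:R
         = (h + k) / 2 * t%:R ^+ 2 + (h + k) / 2 * t%:R + 1 :> R) &
      (h^-1 + k^-1 = 1 ->
         quadQ h k = convex_hull [set (0, 0); (h, 0); (0, k)])].
Proof.
have formula := ehrhart_quadQ_formula h k h_gt0 k_gt0 h_irr hk_int.
split; [exact: quadQ_polygon| |exact: formula|exact: quadQ_degenerate].
split.
- by exists [:: (0, 0); (h, 0); (1, 1); (0, k)]; exact: quadQ_polygon.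
- apply: quadQ_not_integer_polygon => //; apply/negP => /intrP[m hm].
  by have := irrational_mul_nat_neq_int h h_irr 1 m isT; rewrite mul1r hm eqxx.
- exists ((h + k) / 2 *: 'X^2 + (h + k) / 2 *: 'X + 1) => t t0.
  by rewrite formula// !hornerE.
Qed.
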